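(* Let $n\ge0$ be an integer, $\beta$ a complex number, and $H_n^\beta=F_nE^{n\beta}F_n^{-1}$ acting on the space $\mathcal P_n$ of complex polynomials of degree at most $n$. Then for every $p=0,1,\dots,n$, $$H_n^\beta x^p=\sum_{m=p}^{n}\binom{n-p}{n-m}\binom{n+m}{m}^{-1}(1-x)^{n-m}\,t_m\big(-n\beta+n+m\,\big|\,n\beta,x\big),$$ where $t_k(\varphi|\gamma,x)=\sum_{j=0}^{k}\binom{\varphi}{j}\binom{\gamma}{k-j}x^j$.
   Context: $F_n$ is the linear operator on $\mathcal P_n$ with $F_n x^p=(1-x)^{2n+1}\sum_{m\ge0}m^p\binom{m+n}{n}x^m$, $p=0,\dots,n$ (a polynomial of degree $\le n$; $0^0=1$); it is invertible with $F_n^{-1}x^p=\frac{n!}{(2n)!}(x)_p[x+n+1]_{n-p}$, where $(\varphi)_k=\varphi(\varphi-1)\cdots(\varphi-k+1)$, $[\varphi]_k=\varphi(\varphi+1)\cdots(\varphi+k-1)$. $E^{c}$ is the shift $f(x)\mapsto f(x+c)$. $\binom{c}{k}=c(c-1)\cdots(c-k+1)/k!$ for complex $c$. *)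

(* Defs.v *)
(* K is specialised to the complex numbers R[i], R : realType. *)
From HB Require Import structures.
From mathcomp Require Import all_boot all_order all_algebra.
From mathcomp Require Import zify ring.
From mathcomp Require Export complex.
From mathcomp Require Export reals.

Set Implicit Arguments.
Unset Strict Implicit.
Unset Printing Implicit Defensive.

Import Order.TTheory GRing.Theory Num.Theory.
Local Open Scope ring_scope.

Definition falling (A : pzRingType) (x : A) (k : nat) : A :=
  \prod_(i < k) (x - i%:R).

Definition rising (A : pzRingType) (x : A) (k : nat) : A :=
  \prod_(i < k) (x + i%:R).

Definition gbinom (K : numFieldType) (c : K) (k : nat) : K :=
  falling c k / k`!%:R.

(* t_k(phi | gamma, x) as a polynomial in x *)
Definition tpoly (K : numFieldType) (k : nat) (phi gamma : K) : {poly K} :=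
  \sum_(0 <= j < k.+1) (gbinom phi j * gbinom gamma (k - j)) *: 'X^j.

(* Formal power series are coefficient sequences; this is the Cauchy product. *)
Definition series_mul (K : numFieldType) (a b : nat -> K) : nat -> K :=
  fun k => \sum_(i < k.+1) a i * b (k - i)%N.

(* (1-x)^(2n+1) * \sum_m m^p binom(m+n, n) x^m ; note that 0 ^+ 0 = 1. *)
Definition F_series (K : numFieldType) (n p : nat) : nat -> K :=
  series_mul (fun i => ((1 - 'X) ^+ (2 * n).+1 : {poly K})`_i)
             (fun m => m%:R ^+ p * 'C(m + n, n)%:R).

(* The space P_n is {poly_n.+1 K}: polynomials of size at most n+1.           *)
(* mk_npoly keeps the coefficients 0..n of the series; F_opXn shows that      *)
(* nothing is lost.                                                           *)
Definition F_op (K : numFieldType) (n : nat) : 'End({poly_n.+1 K}) :=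
  linfun (fun q : {poly_n.+1 K} =>
    \sum_(p < n.+1) q`_p *: mk_npoly n.+1 (F_series K n p)).

(* npolyp only injects q(x + c), of size at most n+1, into P_n: see E_opE. *)
Definition E_op (K : numFieldType) (n : nat) (c : K) : 'End({poly_n.+1 K}) :=
  linfun (fun q : {poly_n.+1 K} =>
    npolyp n.+1 ((q : {poly K}) \Po ('X + c%:P))).

(* (f^-1)%VF is the two-sided inverse since F_op is bijective: F_op_lker0. *)
Definition H_op (K : numFieldType) (n : nat) (beta : K) :
    'End({poly_n.+1 K}) :=
  (F_op K n \o E_op n (n%:R * beta) \o (F_op K n)^-1)%VF.

Section OperatorFacts.
Variable K : numFieldType.
Implicit Types (A B : {poly K}) (s : nat -> K).

Let smul A s := series_mul (fun i => A`_i) s.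

Let smulE A s k : smul A s k = (A * \poly_(m < k.+1) s m)`_k.
Proof.
rewrite coefM; apply: eq_bigr => i _; rewrite coef_poly.
by rewrite ltnS leq_subr.
Qed.

Let eq_smul A s1 s2 : s1 =1 s2 -> smul A s1 =1 smul A s2.
Proof. by move=> e k; apply: eq_bigr => i _; rewrite e. Qed.

Let smulM A B s k : smul (A * B) s k = smul A (smul B s) k.
Proof.
rewrite smulE -mulrA coefM; apply: eq_bigr => i _; congr (_ * _).
rewrite coefM; apply: eq_bigr => j _; congr (_ * _); rewrite coef_poly.
by rewrite ifT //; have := ltn_ord i; have := ltn_ord j; lia.
Qed.

Let smul1X s k :
  smul (1 - 'X) s k = s k - (if k is k'.+1 then s k' else 0).
Proof.
rewrite smulE mulrBl mul1r coefB coefXM !coef_poly ltnSn.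
by case: k => //= k; rewrite ltnS leqnSn.
Qed.

Let smul_bin N p k :
  smul ((1 - 'X) ^+ N.+1)
    (fun m => if (m < p)%N then 0 else 'C(m - p + N, N)%:R) k = (k == p)%:R.
Proof.
elim: N k => [|N IHN] k.
  rewrite expr1 smul1X; case: k => [|k].
    by case: p => [|p] //=; rewrite ?bin0 subr0.
  rewrite !bin0; case: (ltngtP k.+1 p) => h.
  - by rewrite subrr.
  - by rewrite subrr.
  - by rewrite subr0.
rewrite exprSr smulM -IHN; apply: eq_smul => m; rewrite smul1X.
case: ltnP => h.
  case: m h => [|m] h; first by rewrite subrr.
  by rewrite (ltn_trans _ h) ?subrr.
case: m h => [|m] h.
  by rewrite subr0 sub0n !add0n !binn.
case: ltnP => h'.
  have -> : (m.+1 - p = 0)%N by lia.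
  by rewrite !add0n !binn subr0.
by rewrite subSn // addSn binS addnS natrD addSn addrC addKr.
Qed.

Let fallingE m p : falling (m%:R : K) p = (m ^_ p)%:R.
Proof.
rewrite /falling; elim: p => [|p IHp]; first by rewrite big_ord0.
rewrite big_ord_recr IHp /= ffactnSr natrM.
case: (leqP p m) => h; first by rewrite natrB.
by rewrite ffact_small // !mul0r.
Qed.

Let risingE m k : rising ((m.+1)%:R : K) k = ((m + k) ^_ k)%:R.
Proof.
rewrite /rising; elim: k => [|k IHk]; first by rewrite big_ord0.
rewrite big_ord_recr IHk /= addnS ffactSS mulrC -natrD -natrM.
by rewrite addSn.
Qed.

Let G n p : {poly K} := (n`!%:R / (2 * n)`!%:R) *:
  (falling 'X p * rising ('X + n.+1%:R) (n - p)).

Let horner_falling A p x : (falling A p).[x] = falling A.[x] p.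
Proof.
rewrite /falling horner_prod; apply: eq_bigr => i _.
by rewrite !hornerE -polyC_natr hornerC.
Qed.

Let horner_rising A p x : (rising A p).[x] = rising A.[x] p.
Proof.
rewrite /rising horner_prod; apply: eq_bigr => i _.
by rewrite !hornerE -polyC_natr hornerC.
Qed.

Let size_falling p : size (falling ('X : {poly K}) p) = p.+1.
Proof.
rewrite /falling; under eq_bigr do rewrite -polyC_natr.
by rewrite size_prod_XsubC [index_enum _]unlock -enumT size_enum_ord.
Qed.

Let size_rising c p : size (rising ('X + c%:P : {poly K}) p) = p.+1.
Proof.
rewrite /rising.
rewrite (eq_bigr (fun i : 'I_p => 'X - (- (c + i%:R))%:P)); last first.
  by move=> i _; rewrite -polyC_natr polyCN polyCD opprK addrA.
by rewrite size_prod_XsubC [index_enum _]unlock -enumT size_enum_ord.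
Qed.

Let sizeG n p : (p <= n)%N -> (size (G n p) <= n.+1)%N.
Proof.
move=> hp; apply: leq_trans (size_scale_leq _ _) _.
apply: leq_trans (size_polyMleq _ _) _.
by rewrite size_falling -polyC_natr size_rising; lia.
Qed.

Let nat_key n p r : (p <= n)%N ->
  (n`! * ((p + r) ^_ p * (p + r + n + (n - p)) ^_ (n - p))
    * 'C(p + r + n, n) = 'C(r + 2 * n, 2 * n) * (2 * n)`!)%N.
Proof.
move=> hp.
have e1 : ((p + r) ^_ p * r`! = (p + r)`!)%N.
  by rewrite -{2}(addKn p r) ffact_fact // leq_addr.
have e2 : ((p + r + n + (n - p)) ^_ (n - p) * (p + r + n)`!
    = (r + 2 * n)`!)%N.
  have {2}-> : (p + r + n = p + r + n + (n - p) - (n - p))%N by lia.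
  by rewrite ffact_fact; [congr _`!; lia | lia].
have e3 : ('C(p + r + n, n) * (n`! * (p + r)`!) = (p + r + n)`!)%N.
  by rewrite -{2}(addnK n (p + r)%N) bin_fact // leq_addl.
have e4 : ('C(r + 2 * n, 2 * n) * ((2 * n)`! * r`!) = (r + 2 * n)`!)%N.
  by rewrite -{2}(addnK (2 * n) r)%N bin_fact // leq_addl.
apply/eqP; rewrite -(eqn_pmul2r (fact_gt0 r)); apply/eqP.
by rewrite -[RHS]mulnA e4 -e2 -e3 -e1; ring.
Qed.

Let S n A := smul ((1 - 'X) ^+ (2 * n).+1)
  (fun m => A.[m%:R] * 'C(m + n, n)%:R).

Let SG n p k : (p <= n)%N -> S n (G n p) k = (k == p)%:R.
Proof.
move=> hp; rewrite -(smul_bin (2 * n)); apply: eq_smul => m.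
rewrite /G hornerZ hornerM horner_falling horner_rising.
rewrite hornerD hornerX -polyC_natr hornerC -natrD addnS fallingE risingE.
case: ltnP => h; first by rewrite ffact_small // !(mul0r, mulr0).
have f0 : ((2 * n)`!%:R : K) != 0 by rewrite pnatr_eq0 -lt0n fact_gt0.
have := nat_key (m - p) hp; rewrite subnKC // => e.
apply: (mulIf f0); rewrite -[RHS]natrM -e !natrM.
by field.
Qed.

Let S_sum n (I : finType) (a : I -> K) (f : I -> {poly K}) k :
  S n (\sum_i a i *: f i) k = \sum_i a i * S n (f i) k.
Proof.
rewrite /S /smul /series_mul.
under [RHS]eq_bigr do rewrite mulr_sumr.
rewrite exchange_big /=; apply: eq_bigr => j _.
rewrite horner_sum mulr_suml mulr_sumr; apply: eq_bigr => i _.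
by rewrite hornerZ; ring.
Qed.

Let F_seriesE n p : F_series K n p =1 S n 'X^p.
Proof. by move=> k; apply: eq_bigr => i _; rewrite hornerXn. Qed.

Let F_fun n (q : {poly_n.+1 K}) :=
  \sum_(p < n.+1) q`_p *: mk_npoly n.+1 (F_series K n p).

Let F_fun_linear n : linear (@F_fun n).
Proof.
move=> a u v; rewrite /F_fun scaler_sumr -big_split /=.
by apply: eq_bigr => i _; rewrite coefD coefZ scalerDl scalerA.
Qed.

Let F_opE n q : F_op K n q = F_fun q.
Proof.
pose linF := GRing.isLinear.Build K {poly_n.+1 K} {poly_n.+1 K} _
  (@F_fun n) (@F_fun_linear n).
pose f : {linear {poly_n.+1 K} -> {poly_n.+1 K}} := HB.pack (@F_fun n) linF.
exact: (lfunE f q).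
Qed.

Let npoly_sum n (q : {poly_n.+1 K}) :
  (q : {poly K}) = \sum_(i < n.+1) q`_i *: 'X^i.
Proof.
rewrite -{1}(coefK q); apply/polyP => k; rewrite -(poly_def n.+1).
rewrite !coef_poly; case: ltnP => h; case: ltnP => h' //.
  by have := size_npoly q; lia.
by rewrite nth_default.
Qed.

Let F_op_coef n (q : {poly_n.+1 K}) k :
  (F_op K n q)`_k = if (k < n.+1)%N then S n q k else 0.
Proof.
rewrite F_opE /F_fun coefn_sum; case: ltnP => h; last first.
  by rewrite big1 // => i _; rewrite coefZ coef_poly ltnNge h mulr0.
rewrite [in RHS](npoly_sum q) S_sum; apply: eq_bigr => i _.
by rewrite coefZ coef_poly h F_seriesE.
Qed.

Let F_opG n p : (p <= n)%N ->
  F_op K n (npolyp n.+1 (G n p)) = npolyp n.+1 'X^p.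
Proof.
move=> hp; apply/npolyP => k.
rewrite F_op_coef coef_npolyp coefXn; case: ifP => // _.
by rewrite npolypK ?sizeG // SG.
Qed.

Let npoly_sumX n (q : {poly_n.+1 K}) :
  q = \sum_(i < n.+1) q`_i *: npolyp n.+1 'X^i.
Proof.
apply/val_inj; rewrite /= [LHS]npoly_sum raddf_sum /=.
apply: eq_bigr => i _; rewrite npolypK // size_polyXn ltnS.
exact: leq_ord.
Qed.

Lemma F_op_lker0 n : lker (F_op K n) == 0%VS.
Proof.
have full : limg (F_op K n) = fullv.
  apply/vspaceP => q; rewrite memvf [q]npoly_sumX.
  apply: memv_suml => i _; apply: memvZ.
  by rewrite -(F_opG (leq_ord i)) memv_img ?memvf.
have := limg_ker_dim (F_op K n) fullv.
rewrite full capfv => /eqP; rewrite -{2}[\dim fullv]add0n eqn_add2r.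
by rewrite dimv_eq0.
Qed.

Lemma F_op_invXn n p : (p <= n)%N ->
  ((F_op K n)^-1)%VF (npolyp n.+1 'X^p) =
    (n`!%:R / (2 * n)`!%:R) *:
      (falling 'X p * rising ('X + n.+1%:R) (n - p)) :> {poly K}.
Proof.
move=> hp; rewrite -F_opG // lker0_lfunK ?F_op_lker0 //.
by rewrite npolypK // sizeG.
Qed.

Lemma F_opXn n p k : (p <= n)%N ->
  (F_op K n (npolyp n.+1 'X^p))`_k = F_series K n p k.
Proof.
move=> hp; rewrite F_op_coef F_seriesE.
have -> : npolyp n.+1 'X^p = 'X^p :> {poly K}.
  by rewrite npolypK // size_polyXn.
case: ltnP => // hk.
pose q : {poly_n.+1 K} := npolyp n.+1 'X^p.
have eq_q : 'X^p = \sum_(i < n.+1) (F_op K n q)`_i *: G n i :> {poly K}.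
  transitivity (q : {poly K}); first by rewrite npolypK // size_polyXn.
  rewrite -[in LHS](lker0_lfunK (F_op_lker0 n) q).
  rewrite [in LHS](npoly_sumX (F_op K n q)) linear_sum raddf_sum /=.
  by apply: eq_bigr => i _; rewrite linearZ /= F_op_invXn // leq_ord.
rewrite eq_q S_sum big1 // => i _; rewrite SG ?leq_ord //.
by rewrite gtn_eqF ?mulr0 //; have := ltn_ord i; lia.
Qed.

Let E_fun n (c : K) (q : {poly_n.+1 K}) :=
  npolyp n.+1 ((q : {poly K}) \Po ('X + c%:P)).

Let E_fun_linear n c : linear (@E_fun n c).
Proof.
move=> a u v; apply/npolyP => k.
rewrite /E_fun coefD coefZ !coef_npolyp /= linearP coefD coefZ.
by case: ifP => // _; rewrite mulr0 addr0.
Qed.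

Lemma E_opE n c (q : {poly_n.+1 K}) :
  E_op n c q = (q : {poly K}) \Po ('X + c%:P) :> {poly K}.
Proof.
pose linE := GRing.isLinear.Build K {poly_n.+1 K} {poly_n.+1 K} _
  (@E_fun n c) (@E_fun_linear n c).
pose f : {linear {poly_n.+1 K} -> {poly_n.+1 K}} := HB.pack (@E_fun n c) linE.
have -> : E_op n c q = E_fun c q by exact: (lfunE f q).
rewrite npolypK // size_comp_poly2 //.
by rewrite size_XaddC.
Qed.

End OperatorFacts.

(* Main.v *)
Require Import Defs.
From mathcomp Require Import all_boot all_order all_algebra.
From mathcomp Require Import ring zify.
Set Implicit Arguments.
Unset Strict Implicit.
Unset Printing Implicit Defensive.

Import Order.TTheory GRing.Theory Num.Theory.
Local Open Scope ring_scope.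
Local Open Scope complex_scope.

(** Write [Phi_M] for the linear map [x^j |-> (z)_j [z+n+1]_(M-j)], so that
    [F_n^-1 = n!/(2n)! Phi_n], and put [c = n beta].  Since the two ways of
    extending a basis product, by [z - j] or by [z+n+1+M-j], differ by the
    constant [n+M+1], one has [Phi_(M+1) ((1-x) q) = (n+M+1) Phi_M q], and a
    two-term recurrence in [m] gives
    [Phi_m (t_m(n+m-c | c, x)) = (n+m)!/n! binom(z+c, m)].
    Hence [F_n^-1] sends the right-hand side of the theorem to
    [sum_m binom(n-p, n-m) binom(n+m, m)^-1 binom(z+c, m)], which by
    Vandermonde's identity is [F_n^-1 x^p] evaluated at [z+c]. *)

(** * Falling and rising factorials, up to Vandermonde's identity *)

Lemma falling0 (A : pzRingType) (x : A) : falling x 0 = 1.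
Proof. exact: big_ord0. Qed.

Lemma fallingS (A : pzRingType) (x : A) k :
  falling x k.+1 = falling x k * (x - k%:R).
Proof. exact: big_ord_recr. Qed.

Lemma risingS (A : pzRingType) (x : A) k :
  rising x k.+1 = rising x k * (x + k%:R).
Proof. exact: big_ord_recr. Qed.

Lemma rising_falling (A : comPzRingType) (x : A) k :
  rising (x + 1) k = falling (x + k%:R) k.
Proof.
rewrite /rising /falling (reindex_inj rev_ord_inj) /=.
apply: eq_bigr => i _; rewrite -!addrA; congr (x + _).
by rewrite -natrB ?(ltnW (ltn_ord i)) // addrC natr1 /= subnSK.
Qed.

Lemma falling_cat (A : pzRingType) (x : A) k l :
  falling x (k + l) = falling x k * falling (x - k%:R) l.
Proof.
rewrite /falling big_split_ord /=; congr (_ * _).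
by apply: eq_bigr => i _; rewrite natrD opprD addrA.
Qed.

Lemma falling_nat (A : comPzRingType) m k :
  (k <= m)%N -> falling (m%:R : A) k * (m - k)`!%:R = m`!%:R.
Proof.
elim: k => [|k IHk] hk; first by rewrite falling0 mul1r subn0.
rewrite -IHk ?(ltnW hk) // fallingS -mulrA -natrB ?(ltnW hk) //.
by rewrite -natrM -{1}(subnSK hk) -factS subnSK.
Qed.

(** Summation device behind every two-term recurrence below: the contributions at [j] and [j+1] are
    merged into one longer sum. As [a] vanishes at [m+1], the top coefficient is just [b m]. *)
Lemma sum_shift (A : pzRingType) m (a b w u : nat -> A) :
  a m.+1 = 0 -> w 0%N = a 0%N ->
  (forall j, (j <= m)%N -> w j.+1 = a j.+1 + b j) ->
  \sum_(j < m.+1) (a j * u j + b j * u j.+1) = \sum_(j < m.+2) w j * u j.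
Proof.
move=> am w0 wS; rewrite big_split /= [RHS]big_ord_recl /= w0.
rewrite /bump /=; under [in RHS]eq_bigr => j _ do rewrite add1n wS -1?ltnS // mulrDl.
rewrite big_split /= addrA; congr (_ + _).
rewrite [X in _ + X]big_ord_recr /= am mul0r addr0 big_ord_recl.
by congr (_ + _); apply: eq_bigr => j _; rewrite /= add1n.
Qed.

(** Induction on [N]: the new factor splits as x + y - N = (x - i) + (y - (N - i)), each half
    extends one of the two falling factorials, and Pascal's rule merges the terms. *)
Lemma falling_addr (A : comPzRingType) (x y : A) N :
  falling (x + y) N =
    \sum_(i < N.+1) 'C(N, i)%:R * (falling x i * falling y (N - i)).
Proof.
elim: N => [|N IHN]; first by rewrite big_ord1 !falling0 bin0 !mulr1.
rewrite fallingS IHN mulr_suml.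
rewrite -(@sum_shift A N (fun i => 'C(N, i)%:R) (fun i => 'C(N, i)%:R)
  (fun i => 'C(N.+1, i)%:R)
  (fun i => falling x i * falling y (N.+1 - i))) ?bin0 //; last first.
- by move=> j _; rewrite binS natrD.
- by rewrite bin_small.
apply: eq_bigr => i _; have iN : (i <= N)%N by rewrite -ltnS.
rewrite subSS (subSn iN) !fallingS natrB //; ring.
Qed.

(** In characteristic 0 the naturals are distinct, so [p - q] has at least as many roots as its
    size. *)
Lemma horner_ext (K : numFieldType) (p q : {poly K}) :
  (forall x, p.[x] = q.[x]) -> p = q.
Proof.
move=> e; apply/eqP; rewrite -subr_eq0.
apply/eqP/(@roots_geq_poly_eq0 _ _ [seq i%:R | i <- iota 0 (size (p - q))]).
- by apply/allP => x _; rewrite rootE hornerD hornerN e subrr.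
- rewrite map_inj_uniq ?iota_uniq // => i j /eqP.
  by rewrite eqr_nat => /eqP.
- by rewrite size_map size_iota.
Qed.

Section Phi.
Variable K : numFieldType.
Implicit Types (q : {poly K}) (z c x : K).

Lemma horner_falling (A : {poly K}) p x : (falling A p).[x] = falling A.[x] p.
Proof.
rewrite /falling horner_prod; apply: eq_bigr => i _.
by rewrite !hornerE -polyC_natr hornerC.
Qed.

Lemma horner_rising (A : {poly K}) p x : (rising A p).[x] = rising A.[x] p.
Proof.
rewrite /rising horner_prod; apply: eq_bigr => i _.
by rewrite !hornerE -polyC_natr hornerC.
Qed.

(** * Binomial coefficients with arbitrary upper argument *)

Lemma gbinom0 c : gbinom c 0 = 1.
Proof. by rewrite /gbinom falling0 divr1. Qed.

Lemma gbinomS c k : (k.+1)%:R * gbinom c k.+1 = (c - k%:R) * gbinom c k.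
Proof.
rewrite /gbinom fallingS factS natrM.
have k0 : (k.+1)%:R != 0 :> K by rewrite pnatr_eq0.
have f0 : k`!%:R != 0 :> K by rewrite pnatr_eq0 -lt0n fact_gt0.
by field; rewrite f0 nat1r k0.
Qed.

Lemma gbinom1 c : gbinom c 1 = c.
Proof. by have := gbinomS c 0; rewrite gbinom0 subr0 mulr1 mul1r. Qed.

Lemma gbinom_pascal c k : gbinom (c + 1) k.+1 = gbinom c k.+1 + gbinom c k.
Proof.
elim: k => [|k IHk].
  by rewrite !gbinom1 gbinom0.
have k0 : (k.+2)%:R != 0 :> K by rewrite pnatr_eq0.
apply: (mulfI k0); rewrite gbinomS mulrDr gbinomS IHk.
have := gbinomS c k; rewrite -natr1 => e.
rewrite -[k.+2%:R]natr1 -natr1 mulrDr.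
have -> : (c + 1 - (k%:R + 1)) * gbinom c k = (c - k%:R) * gbinom c k by ring.
by rewrite -e; ring.
Qed.

(** * The maps [Phi] and multiplication by powers of 1 - x *)

Definition Phi n M z q : K :=
  \sum_(j < M.+1) q`_j * (falling z j * rising (z + n.+1%:R) (M - j)).

Lemma Phi_sum n M z (I : Type) (r : seq I) (P : pred I)
    (a : I -> K) (f : I -> {poly K}) :
  Phi n M z (\sum_(i <- r | P i) a i *: f i) =
    \sum_(i <- r | P i) a i * Phi n M z (f i).
Proof.
rewrite /Phi; under [RHS]eq_bigr do rewrite mulr_sumr.
rewrite exchange_big /=; apply: eq_bigr => j _.
rewrite coef_sum mulr_suml; apply: eq_bigr => i _.
by rewrite coefZ -mulrA.
Qed.

(** The constant is (z + n + 1 + M - j) - (z - j). The size bound makes the coefficient of [q] at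
    [M+1], which [Phi n M] ignores, equal to 0. *)
Lemma Phi_mul1X n M z q : (size q <= M.+1)%N ->
  Phi n M.+1 z ((1 - 'X) * q) = (n + M.+1)%:R * Phi n M z q.
Proof.
move=> sq; rewrite /Phi mulr_sumr.
rewrite -(@sum_shift K M (fun j => q`_j) (fun j => - q`_j)
  (fun j => ((1 - 'X) * q)`_j)
  (fun j => falling z j * rising (z + n.+1%:R) (M.+1 - j))).
- apply: eq_bigr => j _; have jM : (j <= M)%N by rewrite -ltnS.
  rewrite subSS (subSn jM) fallingS risingS natrB // natrD -!natr1; ring.
- by rewrite nth_default.
- by rewrite mulrBl mul1r coefB coefXM subr0.
- by move=> j _; rewrite mulrBl mul1r coefB coefXM.
Qed.

Lemma size_mul_exp1X m i q :
  (size q <= m.+1)%N -> (size ((1 - 'X) ^+ i * q)%R <= (m + i).+1)%N.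
Proof.
move=> sq; elim: i => [|i IHi]; first by rewrite expr0 mul1r addn0.
rewrite exprS -mulrA; apply: leq_trans (size_polyMleq _ _) _.
have -> : size (1 - 'X : {poly K}) = 2%N.
  by rewrite -opprB size_polyN size_XsubC.
by rewrite addnS.
Qed.

Lemma Phi_mul_exp1X n m i z q : (size q <= m.+1)%N ->
  Phi n (m + i) z ((1 - 'X) ^+ i * q) * (n + m)`!%:R =
    (n + m + i)`!%:R * Phi n m z q.
Proof.
move=> sq; elim: i => [|i IHi]; first by rewrite expr0 mul1r !addn0 mulrC.
rewrite addnS exprS -mulrA Phi_mul1X ?size_mul_exp1X //.
by rewrite -mulrA IHi mulrA -natrM !addnS factS addnA.
Qed.

(** * Values of [Phi] on the polynomials t_m *)

Lemma tpolyE m phi c :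
  tpoly m phi c = \poly_(j < m.+1) (gbinom phi j * gbinom c (m - j)).
Proof. by rewrite /tpoly big_mkord poly_def. Qed.

Lemma coef_tpoly m phi c j :
  (tpoly m phi c)`_j =
    if (j <= m)%N then gbinom phi j * gbinom c (m - j) else 0.
Proof. by rewrite tpolyE coef_poly ltnS. Qed.

Lemma size_tpoly m phi c : (size (tpoly m phi c) <= m.+1)%N.
Proof. by rewrite tpolyE size_poly. Qed.

Lemma Phi_tpoly n m z c :
  Phi n m z (tpoly m (- c + n%:R + m%:R) c) * n`!%:R =
    (n + m)`!%:R * gbinom (z + c) m.
Proof.
elim: m => [|m IHm].
  rewrite /Phi big_ord1 coef_tpoly /= !gbinom0 falling0 /rising big_ord0 addn0.
  by rewrite !mulr1 mul1r.
have m0 : (m.+1)%:R != 0 :> K by rewrite pnatr_eq0.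
apply: (mulfI m0); rewrite [RHS]mulrCA gbinomS addnS factS natrM.
(* It remains to prove (m+1) Phi_(m+1)(t_(m+1)) = (n+m+1) (z+c-m) Phi_m(t_m). *)
transitivity ((n + m).+1%:R * (z + c - m%:R) *
   (Phi n m z (tpoly m (- c + n%:R + m%:R) c) * n`!%:R)); last first.
  by rewrite IHm; ring.
rewrite !mulrA; congr (_ * _).
set phi := - c + n%:R + m%:R.
have -> : - c + n%:R + (m.+1)%:R = phi + 1 by rewrite /phi -natr1; ring.
rewrite /Phi !mulr_sumr.
under eq_bigr => j _ do rewrite mulrA.
(* Pascal's rule splits the coefficients of (m+1) t_(m+1) so that the j-th pair of terms is a
   multiple of the j-th term of Phi_m(t_m). *)
rewrite -(@sum_shift K m
  (fun j => (m.+1 - j)%:R * gbinom c (m.+1 - j) * gbinom phi j)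
  (fun j => (phi - j%:R + m.+1%:R) * gbinom phi j * gbinom c (m - j))
  (fun j => m.+1%:R * (tpoly m.+1 (phi + 1) c)`_j)
  (fun j => falling z j * rising (z + n.+1%:R) (m.+1 - j))).
(* The multiplier does not depend on j: (c-m+j)(z+n+1+m-j) + (phi-j+m+1)(z-j) = (n+m+1)(z+c-m) when
   phi = n+m-c. *)
- apply: eq_bigr => j _; have jm : (j <= m)%N by rewrite -ltnS.
  rewrite coef_tpoly jm subSS (subSn jm) gbinomS fallingS risingS /phi.
  rewrite natrB // -!natr1 natrD; ring.
- by rewrite subnn !mul0r.
- by rewrite coef_tpoly /= subn0 !gbinom0 mulr1 mul1r.
move=> j jm; rewrite coef_tpoly ltnS jm subSS gbinom_pascal.
have e := gbinomS phi j.
rewrite [(_ + m.+1%:R) * _]mulrDl -e natrB // -!natr1; ring.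
Qed.

(** The rising factorial is the falling factorial of (z-p) + 2n of length n-p. Vandermonde expands
    it, (z)_p absorbs (z-p)_i into (z)_m with m = p+i, and (2n)_(n-p-i) = (2n)!/(n+m)! yields the
    inverse binomial. *)
Lemma falling_rising_expand n p z : (p <= n)%N ->
  n`!%:R / (2 * n)`!%:R * (falling z p * rising (z + n.+1%:R) (n - p)) =
    \sum_(p <= m < n.+1)
      ('C(n - p, n - m)%:R * ('C(n + m, m)%:R)^-1) * gbinom z m.
Proof.
move=> pn.
have -> : z + n.+1%:R = z + n%:R + 1 by rewrite -natr1 addrA.
rewrite rising_falling -[z + _ + _]addrA -natrD.
have -> : z + (n + (n - p))%:R = (z - p%:R) + (2 * n)%:R.
  rewrite -addrA; congr (_ + _); rewrite addrC -natrB; last by lia.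
  by congr _%:R; lia.
rewrite falling_addr -[X in index_iota X _]add0n big_addn big_mkord.
have -> : (n.+1 - p = (n - p).+1)%N by lia.
rewrite mulrA mulr_sumr; apply: eq_bigr => i _.
have ip : (i <= n - p)%N by rewrite -ltnS.
have -> : (n - (i + p) = n - p - i)%N by lia.
rewrite bin_sub //; set B := 'C(_, i)%:R.
rewrite /gbinom [(i + p)%N]addnC falling_cat.
have := @falling_nat K (2 * n) (n - p - i).
have -> : (2 * n - (n - p - i) = n + (i + p))%N by lia.
move=> /(_ ltac:(lia)) <-.
have := bin_fact (leq_addl n (i + p)); rewrite addnK => e.
rewrite -(addnC p) in e *; rewrite -e !natrM.
have f0 k : (k`!%:R : K) != 0 by rewrite pnatr_eq0 -lt0n fact_gt0.
have b0 : ('C(n + (p + i), p + i)%:R : K) != 0.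
  by rewrite pnatr_eq0 -lt0n bin_gt0 leq_addl.
have r0 : falling ((2 * n)%:R : K) (n - p - i) != 0.
  have := f0 (2 * n)%N; rewrite -(@falling_nat K _ (n - p - i)); last by lia.
  by rewrite mulf_eq0 => /norP [].
field.
by rewrite !f0 b0 -natrM r0.
Qed.

(** By linearity it suffices to treat monomials, on which the sum in [Phi] has a single nonzero
    term. *)
Lemma horner_F_op_inv n z (q : {poly_n.+1 K}) :
  (((F_op K n)^-1)%VF q : {poly K}).[z] =
    n`!%:R / (2 * n)`!%:R * Phi n n z q.
Proof.
have -> : q = \sum_(i < n.+1) q`_i *: npolyp n.+1 'X^i.
  apply/npolyP => k; rewrite /= coefn_sum.
  under eq_bigr => i _ do rewrite coefZ coef_npolyp coefXn.
  case: (ltnP k n.+1) => h.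
    rewrite (bigD1 (Ordinal h)) //= eqxx mulr1 big1 ?addr0 // => i ik.
    by rewrite eq_sym -[_ == _]/(i == Ordinal h) (negPf ik) mulr0.
  rewrite big1 => [|i _]; last by rewrite mulr0.
  by rewrite nth_default // (leq_trans (size_npoly q)).
set r := \sum_(i < _) _.
have -> : (r : {poly K}) = \sum_(i < n.+1) q`_i *: 'X^i.
  rewrite /r raddf_sum /=; apply: eq_bigr => i _.
  by rewrite npolypK // size_polyXn.
rewrite Phi_sum {}/r linear_sum raddf_sum horner_sum mulr_sumr.
apply: eq_bigr => i _; have iN : (i <= n)%N by rewrite -ltnS.
rewrite linearZ /= hornerZ F_op_invXn // hornerZ hornerM.
rewrite horner_falling horner_rising hornerD hornerX -polyC_natr hornerC.
rewrite mulrCA; congr (_ * (_ * _)).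
rewrite /Phi (bigD1 i) //= coefXn eqxx mul1r big1 ?addr0 // => j ji.
by rewrite coefXn -[_ == _]/(j == i) (negPf ji) mul0r.
Qed.

End Phi.

Theorem theorem19 (R : realType) (n : nat) (beta : R[i]) (p : nat)
    (hp : (p <= n)%N) :
  H_op n beta (npolyp n.+1 'X^p) =
    \sum_(p <= m < n.+1)
      ('C(n - p, n - m)%:R * ('C(n + m, m)%:R)^-1) *:
        ((1 - 'X) ^+ (n - m)
         * tpoly m (- (n%:R * beta) + n%:R + m%:R) (n%:R * beta))
  :> {poly R[i]}.
Proof.
set c := n%:R * beta; set rhs := \sum_(_ <= _ < _) _.
(* Ensures that [npolyp] does not truncate the right-hand side. *)
have size_rhs : (size rhs <= n.+1)%N.
  rewrite /rhs big_nat; elim/big_ind: _ => [|u v su sv|m /andP [_ mn]].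
  - by rewrite size_poly0.
  - by rewrite (leq_trans (size_polyD _ _)) // geq_max su sv.
  apply: leq_trans (size_scale_leq _ _) _.
  by have := size_mul_exp1X (n - m) (size_tpoly m (- c + n%:R + m%:R) c);
    rewrite subnKC.
(* [F_op] is invertible, so the claim may be compared after applying its inverse. *)
suff e : E_op n c (((F_op _ n)^-1)%VF (npolyp n.+1 'X^p)) =
         ((F_op _ n)^-1)%VF (npolyp n.+1 rhs).
  by rewrite /H_op !comp_lfunE /= e lker0_lfunVK ?F_op_lker0 // npolypK.
apply/val_inj/horner_ext => z /=.
rewrite E_opE horner_comp hornerD hornerX hornerC F_op_invXn //.
rewrite hornerZ hornerM horner_falling horner_rising hornerD hornerX.
rewrite -polyC_natr hornerC falling_rising_expand // horner_F_op_inv.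
rewrite npolypK // /rhs Phi_sum mulr_sumr !big_nat.
apply: eq_bigr => m /andP [_ mn]; have {}mn : (m <= n)%N by rewrite -ltnS.
(* The two sums now agree term by term, up to the value of [Phi] on (1-x)^(n-m) t_m. *)
rewrite [RHS]mulrCA; congr (_ * _).
have f0 k : (k`!%:R : R[i]) != 0 by rewrite pnatr_eq0 -lt0n fact_gt0.
have e1 := Phi_mul_exp1X n (n - m) z (size_tpoly m (- c + n%:R + m%:R) c).
have e2 := Phi_tpoly n m z c.
(* Since m + (n-m) = n, the factorial in [e1] is (2n)!, which cancels the denominator in the formula
   for the inverse. *)
rewrite -addnA (subnKC mn) addnn -mul2n in e1.
apply: (mulfI (f0 (n + m)%N)); rewrite -e2.
rewrite mulrC [RHS]mulrC -[RHS]mulrA e1; field.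
exact: f0.
Qed.
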